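(* Let $F$ be a nonabelian free group. Then the $3$-local commensurability graph of $F$ has infinite connected diameter.
   Context: For a group $G$ and a prime $p$, the $p$-local commensurability graph $\Gamma_p(G)$ has as vertices all finite-index subgroups of $G$, and an edge is drawn between (distinct) $A$ and $B$ if $[A: A\cap B][B: A\cap B]$ is a power of $p$ (where $1=p^0$ counts as a power of $p$). The connected diameter of a graph is the supremum, over all connected components of the graph, of the graph diameter of the component. *)

(* Defs.v *)
From mathcomp Require Import all_boot all_order all_algebra.
From mathcomp Require Import finmap all_classical reals ereal.

Set Implicit Arguments.
Unset Strict Implicit.
Unset Printing Implicit Defensive.

Local Open Scope classical_set_scope.
Local Open Scope group_scope.

Section Groups.
Variable G : groupType.

(* Universal property of a free group; only the values of [f] on [X] matter. *)
Definition free_basis (X : set G) : Prop :=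
  forall (H : groupType) (f : G -> H),
    exists phi : {multiplicative G -> H},
      {in X, phi =1 f} /\
      forall psi : {multiplicative G -> H}, {in X, psi =1 f} -> psi =1 phi.

Definition free_group : Prop := exists X : set G, free_basis X.

Definition nonabelian : Prop := exists x y : G, x * y <> y * x.

Definition left_cosets (A B : set G) : set (set G) :=
  [set [set x * b | b in B] | x in A].

(* [A : B]; the junk value is 0 when there are infinitely many cosets. *)
Definition group_index (A B : set G) : nat := #|` fset_set (left_cosets A B) |.

Record fi_subgroup := FiSubgroup {
  fi_set :> set G;
  fi_group_closed : group_closed [in fi_set];
  fi_finite_index : finite_set (left_cosets [set: G] fi_set)
}.

Definition plocal_comm_graph (p : nat) : rel fi_subgroup :=
  fun A B => `[< fi_set A <> fi_set B /\
    exists k : nat, (group_index A (A `&` B) * group_index B (A `&` B))%N = (p ^ k)%N >].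

End Groups.

Section Graphs.
Variables (R : realType) (V : Type) (e : rel V).

Definition walk (n : nat) (x y : V) : Prop :=
  exists s : seq V, [/\ path e x s, last x s = y & size s = n].

(* Equal to +oo (the infimum of the empty set) if no walk joins x to y. *)
Definition graph_dist (x y : V) : \bar R :=
  ereal_inf [set n%:R%:E%E | n in [set n : nat | walk n x y]].

Definition component (x : V) : set V := [set y | exists n, walk n x y].

Definition diameter (C : set V) : \bar R :=
  ereal_sup [set graph_dist u.1 u.2 | u in C `*` C].

Definition connected_diameter : \bar R :=
  ereal_sup [set diameter (component x) | x in [set: V]].

End Graphs.

(* Main.v *)
(* F maps onto the symmetric group S_n, n = 2m+1, and a near-perfect matching f
   of the n points gives the elementary abelian 2-subgroup M_f of S_n generated by
   the transpositions of its edges, hence a vertex of the graph, its preimage in F.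
   Sliding the hole h, i.e. replacing an edge {b,c} by {h,b}, is a walk of length 2
   through the preimage of M_f.Sym{h,b,c}, in which both matching groups have
   index 3.
   Conversely, odd-index commensurability preserves the property that a Sylow
   2-subgroup of the image in S_n is a matching group. If M_f is a Sylow 2-subgroup
   of K and M_g lies in K, then K has no element of order 4, whereas the three
   transpositions along a path of length 3 multiply to a 4-cycle. So f and g differ
   only around their holes, at 3 points at most: every step of a walk changes at
   most 3 partners, while m slides can change all of them. *)
From HB Require Import structures.
Require Import Defs.
From mathcomp Require Import all_boot all_order all_algebra.
From mathcomp Require Import fingroup perm action pgroup cyclic sylow zify.
From mathcomp Require boolp.

Set Implicit Arguments.
Unset Strict Implicit.
Unset Printing Implicit Defensive.

(** * Matching groups *)

Section Matchings.
Local Open Scope group_scope.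

Variable T : finType.
Implicit Types (f g : T -> T) (s t : {perm T}) (G H : {group {perm T}}).

(** A matching is encoded as the involution swapping the ends of each edge; a fixed point is a hole,
    and there is at most one. *)
Definition near_matching f : Prop :=
  involutive f /\ forall x y, f x = x -> f y = y -> x = y.

(** For an involution [f] this is the elementary abelian 2-group generated by the transpositions of
    the edges, given pointwise so that membership needs no words in generators. *)
Definition matching_group f : {set {perm T}} :=
  [set s : {perm T} | [forall x, (s x == x) || (s x == f x)]].

Lemma matching_groupP f s :
  reflect (forall x, s x = x \/ s x = f x) (s \in matching_group f).
Proof.
rewrite inE; apply: (iffP forallP) => sf x.
  by case/orP: (sf x) => /eqP; [left|right].
by case: (sf x) => ->; rewrite eqxx ?orbT.
Qed.

Lemma matching_group_set f : involutive f -> group_set (matching_group f).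
Proof.
move=> fK; apply/group_setP; split.
  by apply/matching_groupP => x; left; rewrite perm1.
move=> s t /matching_groupP sf /matching_groupP tf; apply/matching_groupP => x.
rewrite permM.
case: (sf x) => ->; first exact: tf.
by case: (tf (f x)) => ->; rewrite ?fK; auto.
Qed.

Lemma matching_group_sqr f s :
  involutive f -> s \in matching_group f -> s ^+ 2 = 1.
Proof.
move=> fK /matching_groupP sf; apply/permP => x; rewrite expgS expg1 permM perm1.
case: (sf x) => sx; first by rewrite !sx.
by case: (sf (s x)) => [/perm_inj e|->]; [rewrite !e | rewrite sx fK].
Qed.

Lemma tperm_matching_group f x :
  involutive f -> tperm x (f x) \in matching_group f.
Proof.
move=> fK; apply/matching_groupP => z.
by case: tpermP => [->|->|]; rewrite ?fK; auto.
Qed.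

Lemma matching_pgroup f : involutive f -> 2.-group (matching_group f).
Proof.
move=> fK; pose G := group (matching_group_set fK).
apply/(pgroupP (G := G)) => p p_pr /(Cauchy p_pr)[s sG os].
have /dvdn_leq : #[s] %| 2 by rewrite order_dvdn (matching_group_sqr fK sG).
by rewrite os !inE => /(_ isT); case: p p_pr {os} => [|[|[|]]].
Qed.

(** Products of permutations act from left to right, so [s] is the cycle a -> d -> c -> b -> a. *)
Lemma four_cycle (a b c d : T) : uniq [:: a; b; c; d] ->
  let s : {perm T} := tperm a b * tperm b c * tperm c d in s ^+ 4 = 1 /\ s ^+ 2 != 1.
Proof.
rewrite /= !inE !negb_or => /and4P[/and3P[ab ac ad] /andP[bc bd] cd _].
set s : {perm T} := _ * _.
have sE x : s x = tperm c d (tperm b c (tperm a b x)) by rewrite !permM.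
clearbody s.
have sa : s a = d by rewrite sE !tpermL.
have sd : s d = c by rewrite sE (tpermD ad bd) (tpermD bd cd) tpermR.
have sc : s c = b.
  by rewrite sE (tpermD ac bc) tpermR tpermD // eq_sym.
have sb : s b = a by rewrite sE tpermR !tpermD // eq_sym.
have sz z : a != z -> b != z -> c != z -> d != z -> s z = z.
  by move=> *; rewrite sE !tpermD.
split; last first.
  apply/eqP => /permP /(_ a). rewrite expgS expg1 permM perm1. rewrite sa sd.
  by move/eqP; rewrite eq_sym (negPf ac).
apply/permP => z; rewrite !expgS expg0 !permM perm1.
case: (eqVneq a z) => [<-|az]; first by rewrite sa sd sc sb perm1.
case: (eqVneq b z) => [<-|bz]; first by rewrite sb sa sd sc perm1.
case: (eqVneq c z) => [<-|cz]; first by rewrite sc sb sa sd perm1.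
case: (eqVneq d z) => [<-|dz]; first by rewrite sd sc sb sa perm1.
by rewrite !sz ?perm1.
Qed.

(** The 2-group generated by [s] is conjugate in [G] into the Sylow subgroup [matching_group f],
    whose elements square to 1. *)
Lemma sylow_matching_no_order4 f G s : involutive f ->
  2.-Sylow(G) (matching_group f) -> s \in G -> s ^+ 4 = 1 -> s ^+ 2 = 1.
Proof.
move=> fK sylf sG s4.
have s2 : 2.-group <[s]>.
  rewrite /pgroup -orderE; apply: (@pnat_dvd _ 4) => //.
  by rewrite order_dvdn s4.
have [||t tG] := @Sylow_Jsub 2 _ G (group (matching_group_set fK)) <[s]>%G sylf.
- by rewrite cycle_subG.
- exact: s2.
rewrite -cycleJ cycle_subG => /(matching_group_sqr fK)/eqP.
by rewrite -conjXg conjg_eq1 => /eqP.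
Qed.

(** Its cardinal is the Hamming distance between [f] and [g]. *)
Definition disagreement f g := [set x : T | f x != g x].

Lemma disagreement_trans f g h :
  #|disagreement f h| <= #|disagreement f g| + #|disagreement g h|.
Proof.
rewrite (leq_trans _ (leq_card_setU _ _)) // subset_leq_card //.
apply/subsetP => x.
by rewrite !inE; case: (eqVneq (f x) (g x)) => // ->.
Qed.

(* If x and g x both lie on edges of f, then f x, x, g x, f (g x) is a path of
   length 3 in the union of the matchings and its transpositions multiply to a
   4-cycle. *)
Lemma sylow_matching_disagreement f g G :
    near_matching f -> near_matching g ->
    2.-Sylow(G) (matching_group f) -> matching_group g \subset G ->
  #|disagreement f g| <= 3.
Proof.
move=> [fK fu] [gK gu] sylf gG.
have fG : matching_group f \subset G := pHall_sub sylf.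
have le1 (P : pred T) : (forall x y, P x -> P y -> x = y) -> #|[set x | P x]| <= 1.
  by move=> Pu; apply/card_le1_eqP => x y; rewrite !inE => Px Py; exact: Pu.
(* The three sets hold the hole of [f], its partner under [g], and the hole of [g]: at most one
   point each, whence the bound 3. *)
have sub : disagreement f g \subset
    [set x | f x == x] :|: [set x | f (g x) == g x] :|: [set x | g x == x].
  apply/subsetP => x; rewrite !inE => fgx; apply: contraT.
  rewrite !negb_or -andbA => /and3P[fx fgx' gx].
  have [s4 /negP[]] : let s := tperm (f x) x * tperm x (g x) * tperm (g x) (f (g x))
      in s ^+ 4 = 1 /\ s ^+ 2 != 1.
    apply: four_cycle; rewrite /= !inE !negb_or fx fgx (eq_sym x) gx (eq_sym (g x)) fgx'.
    rewrite (inj_eq (can_inj fK)) (eq_sym x (g x)) gx /= andbT.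
    by apply: contraNneq fgx => {1}->; rewrite fK.
  apply/eqP; apply: sylow_matching_no_order4 s4 => //; first exact: sylf.
  rewrite tpermC !groupM //; last 2 first.
  - by apply: (subsetP gG); exact: tperm_matching_group.
  - by apply: (subsetP fG); exact: tperm_matching_group.
  by apply: (subsetP fG); exact: tperm_matching_group.
apply: leq_trans (subset_leq_card sub) _.
apply: leq_trans (leq_card_setU _ _) _; rewrite -[3]/(2 + 1) leq_add //.
  apply: leq_trans (leq_card_setU _ _) _; rewrite -[2]/(1 + 1) leq_add //.
    by apply: le1 => x y /eqP fx /eqP fy; exact: fu.
  apply: le1 => x y /eqP fx /eqP fy; apply: (can_inj gK); exact: fu.
by apply: le1 => x y /eqP gx /eqP gy; exact: gu.
Qed.

Definition conj_fun s f : T -> T := fun x => s (f (s^-1 x)).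

Lemma near_matching_conj s f : near_matching f -> near_matching (conj_fun s f).
Proof.
case=> fK fu; split=> [x|x y]; first by rewrite /conj_fun permK fK permKV.
rewrite /conj_fun => fx fy; apply: (can_inj (permKV s)); apply: fu.
  by rewrite -{2}fx permK.
by rewrite -{2}fy permK.
Qed.

Lemma matching_group_conj s f :
  matching_group (conj_fun s f) = matching_group f :^ s.
Proof.
apply/setP => t; rewrite mem_conjg.
apply/matching_groupP/matching_groupP => tf x.
  rewrite conjgE !invgK !permM.
  case: (tf (s x)) => ->; rewrite /conj_fun ?permK; auto.
have := tf (s^-1 x); rewrite conjgE invgK !permM permKV /conj_fun.
by case=> [/perm_inj|<-]; rewrite ?permKV; auto.
Qed.

(** An odd index leaves the 2-part of the order unchanged. *)
Lemma sylow_odd_index (gT : finGroupType) (G H P : {group gT}) :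
  2.-Sylow(H) P -> H \subset G -> odd #|G : H| -> 2.-Sylow(G) P.
Proof.
move=> sylP sHG oddI; rewrite pHallE (subset_trans (pHall_sub sylP) sHG) /=.
rewrite (card_Hall sylP) -(Lagrange sHG) partnM ?cardG_gt0 //.
by rewrite (@part_p'nat _ #|G : H|) ?muln1 // -odd_2'nat.
Qed.

(** A Sylow 2-subgroup of [H] is also one of [G], hence conjugate to [matching_group f]; conjugation
    only relabels the matching. *)
Lemma sylow_matching_odd_index f G H : near_matching f ->
    2.-Sylow(G) (matching_group f) -> H \subset G -> odd #|G : H| ->
  exists2 g, near_matching g & 2.-Sylow(H) (matching_group g).
Proof.
move=> fm sylf sHG oddI; have [fK _] := fm.
have [P sylP] := Sylow_exists 2 H.
have sylP' := sylow_odd_index sylP sHG oddI.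
have [|t tG Pt] := @Sylow_trans 2 _ G (group (matching_group_set fK)) P _ sylP'.
  exact: sylf.
exists (conj_fun t f); first exact: near_matching_conj.
by rewrite matching_group_conj -[_ :^ _]/(group (matching_group_set fK) :^ t) -Pt.
Qed.

(** When [f] is an involution fixing [h], this is the product of [matching_group f] with the
    symmetric group on [h], [b] and [f b]. *)
Definition hole_group f h b : {set {perm T}} :=
  [set s : {perm T} | [forall x, if x \in [set h; b; f b] then s x \in [set h; b; f b]
                      else (s x == x) || (s x == f x)]].

Section Move.
Variables (f : T -> T) (h b : T).
Hypotheses (fK : involutive f) (fh : f h = h) (hb : h != b) (fb : f b != b).
Let V := [set h; b; f b].

Let fV x : (f x \in V) = (x \in V).
Proof.
rewrite !inE (inj_eq (can_inj fK)) -{1}fh (inj_eq (can_inj fK)).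
by rewrite (can2_eq fK fK) -!orbA; congr (_ || _); rewrite orbC.
Qed.

Let hole_groupP s : reflect
  ((forall x, x \in V -> s x \in V) /\
   (forall x, x \notin V -> s x = x \/ s x = f x)) (s \in hole_group f h b).
Proof.
rewrite inE; apply: (iffP forallP) => [sf|[sV sf] x].
  split=> x xV; have := sf x; first by rewrite xV.
  by rewrite (negPf xV) => /orP[]/eqP; auto.
case: ifPn => [/sV //|/sf[]->]; rewrite eqxx ?orbT //.
Qed.

Lemma hole_group_set : group_set (hole_group f h b).
Proof.
apply/group_setP; split.
  by apply/hole_groupP; split=> x; rewrite perm1; auto.
move=> s t /hole_groupP[sV sf] /hole_groupP[tV tf]; apply/hole_groupP.
split=> x xV; rewrite permM; first by rewrite tV ?sV.
case: (sf x xV) => ->; first exact: tf.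
by have [||] := tf (f x); rewrite ?fV // ?fK => ->; auto.
Qed.

Let J := group hole_group_set.

Lemma tperm_hole_group y : y \in V -> tperm h y \in J.
Proof.
have hV : h \in V by rewrite !inE eqxx.
move=> yV; apply/hole_groupP; split=> x xV; first by case: tpermP.
by left; rewrite tpermD //; apply: contraNneq xV => <-.
Qed.

Lemma matching_group_sub_hole_group : matching_group f \subset J.
Proof.
apply/subsetP => s /matching_groupP sf; apply/hole_groupP.
by split=> x xV; case: (sf x) => ->; rewrite ?fV; auto.
Qed.

(** [matching_group f] is the stabiliser of [h] in [J], and the orbit of [h] is the three-point set
    [V]. *)
Lemma index_hole_group : #|J : matching_group f| = 3.
Proof.
have -> : matching_group f = 'C_J[h | 'P].
  apply/setP => s; apply/idP/idP => [sM|].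
    rewrite inE (subsetP matching_group_sub_hole_group) //=.
    by apply/astab1P; move/matching_groupP: sM => /(_ h); rewrite fh /= /aperm => -[].
  (* An element fixing [h] permutes the other two points [b] and [f b] of [V], so it acts there as
     the identity or as [f]. *)
  rewrite inE => /andP[/hole_groupP[sV sf] /astab1P /= sh].
  rewrite /aperm in sh; apply/matching_groupP => x.
  have [xV|] := boolP (x \in V); last exact: sf.
  have := sV _ xV; case: (eqVneq x h) => [->|xh]; first by rewrite sh; auto.
  have sxh : s x != h.
    by apply: contraNneq xh => sx; apply/eqP/(@perm_inj _ s); rewrite sx sh.
  rewrite !inE (negPf sxh) (negPf xh) /= in xV *.
  by case/orP: xV => /eqP->; case/orP => /eqP->; rewrite ?fK; auto.
rewrite -card_orbit.
have -> : orbit 'P J h = V.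
  apply/setP => y; apply/orbitP/idP => [[s /hole_groupP[sV _] <-]|yV].
    by apply: sV; rewrite !inE eqxx.
  by exists (tperm h y); [exact: tperm_hole_group|rewrite /= /aperm tpermL].
rewrite /V setUC cardsU1 cards2 !inE hb (negPf fb) orbF.
by rewrite -{1}fh (inj_eq (can_inj fK)) eq_sym hb.
Qed.

(** Conjugation by the transposition of [h] and [f b] moves the hole to [f b] and creates the edge
    from [h] to [b]. The transposition lies in [J], so [J] contains the conjugate group with the
    same index. *)
Lemma hole_move : exists K : {group {perm T}},
  [/\ matching_group f \subset K,
      matching_group (conj_fun (tperm h (f b)) f) \subset K,
      #|K : matching_group f| = 3 &
      #|K : matching_group (conj_fun (tperm h (f b)) f)| = 3].
Proof.
have tJ : tperm h (f b) \in J by apply: tperm_hole_group; rewrite !inE eqxx !orbT.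
exists J; split.
- exact: matching_group_sub_hole_group.
- by rewrite matching_group_conj -(conjGid tJ) conjSg matching_group_sub_hole_group.
- exact: index_hole_group.
- rewrite matching_group_conj -{1}(conjGid tJ).
  by rewrite (indexJg J (group (matching_group_set fK))) index_hole_group.
Qed.

End Move.
End Matchings.

(** * An explicit chain of near-perfect matchings on 2m+1 points *)

Section HoleMatching.
Local Open Scope group_scope.

Variable m : nat.
Local Notation I := 'I_(m.*2.+1).

(* The matching {0,1}, ..., {2j-2,2j-1}, {2j+1,2j+2}, ..., {2m-1,2m}. *)
Definition hole_matching (j : nat) (x : I) : I :=
  inord (if x == j.*2 :> nat then x : nat
         else if (x < j.*2) (+) odd x then x.+1 else x.-1).

(** A description by linear arithmetic and parity, in the form that [lia] can use; writing
    [y.+1 = x] avoids truncated predecessors. *)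
Lemma hole_matchingE j (x : I) : j <= m ->
  let y := hole_matching j x : nat in
  x = j.*2 :> nat /\ y = j.*2 \/
  x < j.*2 /\ (~~ odd x /\ y = x.+1 \/ odd x /\ y.+1 = x) \/
  j.*2 < x /\ (odd x /\ y = x.+1 \/ ~~ odd x /\ y.+1 = x).
Proof.
move=> jm; rewrite inordK //; case: x => x /= xm.
  by do !case: ifP => ?; lia.
by do !case: ifP => ?; lia.
Qed.

Lemma near_matching_hole j : j <= m -> near_matching (hole_matching j).
Proof.
move=> jm; split=> [x|x y fx fy]; apply: val_inj => /=.
  have := hole_matchingE x jm; have := hole_matchingE (hole_matching j x) jm.
  by move=> /=; lia.
have := hole_matchingE x jm; have := hole_matchingE y jm.
by rewrite /= fx fy; lia.
Qed.

(** Exchanging the labels 2j and 2j+2 turns the edge {2j+1,2j+2} into {2j,2j+1} and leaves the other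
    edges alone. *)
Lemma hole_matchingS j : j < m ->
  conj_fun (tperm (inord j.*2) (inord j.+1.*2)) (hole_matching j)
    =1 hole_matching j.+1.
Proof.
move=> jm x; apply: val_inj; rewrite /conj_fun tpermV /=.
set a : I := inord _; set b : I := inord _.
have ea : a = j.*2 :> nat by rewrite inordK //; lia.
have eb : b = j.+1.*2 :> nat by rewrite inordK //; lia.
have tE (y : I) : let z := tperm a b y : nat in
    y = j.*2 :> nat /\ z = j.+1.*2 \/ y = j.+1.*2 :> nat /\ z = j.*2 \/
    y <> j.*2 :> nat /\ y <> j.+1.*2 :> nat /\ z = y.
  case: tpermP => [->|->|ya yb] /=; rewrite ?ea ?eb; [lia|lia|].
  right; right; split=> [|]; last split=> // ; move=> e.
    by apply: ya; apply: val_inj; rewrite /= ea.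
  by apply: yb; apply: val_inj; rewrite /= eb.
have := tE x; have := tE (hole_matching j (tperm a b x)).
have := hole_matchingE (tperm a b x) (ltnW jm); have := hole_matchingE x jm.
by move=> /=; lia.
Qed.

Lemma hole_matching_move j : j < m -> exists K : {group {perm I}},
  [/\ matching_group (hole_matching j) \subset K,
      matching_group (hole_matching j.+1) \subset K,
      #|K : matching_group (hole_matching j)| = 3 &
      #|K : matching_group (hole_matching j.+1)| = 3].
Proof.
move=> jm; have [fK _] := near_matching_hole (ltnW jm).
set a : I := inord j.*2; pose b : I := inord j.*2.+1; set c : I := inord j.+1.*2.
have ea : a = j.*2 :> nat by rewrite inordK //; lia.
have eb : b = j.*2.+1 :> nat by rewrite inordK //; lia.
have ec : c = j.+1.*2 :> nat by rewrite inordK //; lia.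
have fb : hole_matching j b = c.
  by apply: val_inj; have := hole_matchingE b (ltnW jm); move=> /=; lia.
have fa : hole_matching j a = a.
  by apply: val_inj; have := hole_matchingE a (ltnW jm); move=> /=; lia.
have [||K] := hole_move fK fa (b := b).
- by rewrite -val_eqE /= ea eb; lia.
- by rewrite fb -val_eqE /= ec eb; lia.
by rewrite fb (boolp.funext (hole_matchingS jm)); exists K.
Qed.

(** Apart from the holes 0 and 2m, an odd x is joined to x+1 in the first matching and to x-1 in the
    last, an even x the other way round. The two holes differ since [m] is positive. *)
Lemma hole_matching_disagreement : 0 < m ->
  #|disagreement (hole_matching 0) (hole_matching m)| = m.*2.+1.
Proof.
move=> m0; rewrite -[RHS]card_ord; apply: eq_card => x; rewrite !inE; apply/eqP => e.
have := hole_matchingE x (leq0n m); have := hole_matchingE x (leqnn m).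
by rewrite /= e; have := ltn_ord x; lia.
Qed.

End HoleMatching.

(** * Generation of the symmetric group by two elements *)

Section SymGenerators.
Local Open Scope group_scope.

(** Conjugating the transposition of 0 and 1 repeatedly by the cycle gives all adjacent
    transpositions; these give all transpositions moving 0, which generate. *)
Lemma gen_tperm_cycle n :
  <<[set tperm ord0 (inord 1); perm (@ordS_inj n.+1)]>> = [set: {perm 'I_n.+1}].
Proof.
pose c := perm (@ordS_inj n.+1); set H := <<_>>.
have tH : tperm ord0 (inord 1) \in H by rewrite mem_gen // !inE eqxx.
have cH : c \in H by rewrite mem_gen // !inE eqxx orbT.
have cE i : i < n -> c (inord i) = inord i.+1.
  move=> ilt; apply: val_inj; rewrite permE /= !inordK //; last lia.
  by rewrite modn_small.
have o0 : inord 0 = ord0 :> 'I_n.+1 by apply: val_inj; rewrite /= inordK.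
have adjH i : i < n -> tperm (inord i) (inord i.+1) \in H.
  elim: i => [|i IH] ilt; first by rewrite o0.
  have -> : tperm (inord i.+1) (inord i.+2) = tperm (inord i) (inord i.+1) ^ c.
    by rewrite tpermJ !cE // ltnW.
  by rewrite groupJ // IH // ltnW.
have zH i : i <= n -> tperm ord0 (inord i) \in H.
  elim: i => [|[|i] IH] ilt; first by rewrite o0 tperm1 group1.
    exact: tH.
  have <- : tperm ord0 (inord i.+1) ^ tperm (inord i.+1) (inord i.+2)
      = tperm ord0 (inord i.+2) :> {perm 'I_n.+1}.
    by rewrite tpermJ tpermL tpermD // -val_eqE /= inordK //; lia.
  by rewrite groupJ ?adjH ?IH // ltnW.
apply/eqP; rewrite eqEsubset subsetT /= -(gen_tperm ord0) gen_subG.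
apply/subsetP => _ /imsetP[x _ ->]; rewrite -(inord_val x).
by apply: zH; rewrite -ltnS.
Qed.

End SymGenerators.

From mathcomp Require Import finmap all_classical reals ereal.

(** * Finite quotients of free groups *)

Section FreeGroups.
Local Open Scope classical_set_scope.
Local Open Scope group_scope.

(** Named so that conjugation can be declared a multiplicative morphism, to which the uniqueness
    clause of [free_basis] applies. *)
Definition conj_by (G : groupType) (x : G) : G -> G := fun y => y ^ x.

Lemma conj_byM (G : groupType) (x : G) : {morph conj_by x : y z / y * z}.
Proof. by move=> y z; rewrite /conj_by conjMg. Qed.

HB.instance Definition _ (G : groupType) (x : G) :=
  isMultiplicative.Build G G (conj_by x) (@conj_byM G x).

(* Conjugation by x is determined by its values on X: if these are trivial for
   x in X, then X is central, and then conjugation by any g is trivial. *)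
Lemma free_basis_noncommuting (F : groupType) (X : set F) :
  free_basis X -> nonabelian F ->
  exists x y, [/\ X x, X y & x * y <> y * x].
Proof.
move=> basX [g [h ngh]]; apply: contrapT => noncom; apply: ngh.
have conj_id x : (forall y, X y -> y ^ x = y) -> forall y, y ^ x = y.
  have [phi [_ uniq]] := basX _ (fun y => y).
  move=> Xx y; have e1 : conj_by x =1 phi.
    by apply: (uniq (conj_by x)) => z /set_mem /Xx.
  have e2 : conj_by 1 =1 phi.
    by apply: (uniq (conj_by 1)) => z _; exact: conjg1.
  by rewrite -[LHS]/(conj_by x y) e1 -e2 /conj_by conjg1.
have central x y : X x -> y ^ x = y.
  move=> Xx; apply: conj_id => z Xz; apply/conjg_fixP/commgP.
  by apply: contrapT => xz; apply: noncom; exists z, x.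
rewrite conjgC conj_id // => y Xy.
by have := conjgC h y; rewrite central // conjgE => <-; rewrite mulKg.
Qed.

(** Two noncommuting basis elements are distinct, so one can be sent to [a] and the rest of the
    basis to [b]. The image is then a subgroup containing both generators. *)
Lemma free_group_surj (F : groupType) (Q : finGroupType) (a b : Q) :
  free_group F -> nonabelian F -> <<[set a; b]%SET>> = [set: Q]%SET ->
  exists phi : {multiplicative F -> Q}, forall q, exists g, phi g = q.
Proof.
move=> [X basX] nab genQ.
have [x [y [Xx Xy xy]]] := free_basis_noncommuting basX nab.
have [phi [phiE _]] := basX Q (fun z => if z == x then a else b).
exists phi.
have phix : phi x = a by rewrite phiE ?inE // eqxx.
have phiy : phi y = b.
  by rewrite phiE ?inE //; case: eqP => // yx; case: xy; rewrite yx.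
pose im := [set q : Q | `[< exists g, phi g = q >]]%SET.
have imP q : reflect (exists g, phi g = q) (q \in im).
  by rewrite finset.in_set; exact: asboolP.
have im_group : group_set im.
  apply/group_setP; split.
    by apply/imP; exists 1; apply: (mulgI (phi 1)); rewrite -gmulfM !mulg1.
  by move=> q r /imP[g <-] /imP[h <-]; apply/imP; exists (g * h); rewrite gmulfM.
have : <<[set a; b]%SET>> \subset group im_group.
  rewrite gen_subG; apply/fintype.subsetP => r.
  by rewrite finset.in_set2 => /orP[] /eqP->; apply/imP; [exists x|exists y].
move/fintype.subsetP => sub q; apply/imP/sub.
by rewrite genQ finset.in_setT.
Qed.

End FreeGroups.

(** * Cosets and edges under a homomorphism *)

Section Cosets.
Local Open Scope classical_set_scope.
Local Open Scope group_scope.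

Lemma cardfsX (S T : choiceType) (A : {fset S}) (B : {fset T}) :
  #|` (A `*` B)%fset| = (#|` A| * #|` B|)%N.
Proof.
rewrite -(size_allpairs pair); apply/perm_size/uniq_perm => // [|[x y]].
  by apply: allpairs_uniq => // -[? ?] [].
rewrite !inE /=; apply/andP/allpairsP => [[xA yB]|[[a b] [? ? [-> ->]]]//].
by exists (x, y).
Qed.

Lemma card_fset_set_finset (T : finType) (A : {set T}) : #|` fset_set [set` A]| = #|A|.
Proof.
rewrite (_ : fset_set _ = [fset x in A]%fset) ?card_finset //.
apply/fsetP => x; rewrite in_fset_set; last exact: finite_finset.
apply/idP/idP => [/set_mem xA|/imfsetP[y /= yA ->]]; last exact: mem_set.
by apply/imfsetP; exists x.
Qed.

Definition is_subgroup (G : groupType) (A : set G) : Prop :=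
  [/\ A 1, forall x y, A x -> A y -> A (x * y) & forall x, A x -> A x^-1].

Lemma group_closed_subgroup (G : groupType) (A : set G) :
  group_closed [in A] <-> is_subgroup A.
Proof.
split=> [cA|[A1 AM AV]].
  split=> [|x y Ax Ay|x Ax]; apply: set_mem.
  - exact: cA.1.
  - by apply: (group_closedM cA); apply: mem_set.
  - by apply: (group_closedV cA); apply: mem_set.
split; first exact: mem_set.
by move=> x y /set_mem Ax /set_mem Ay; apply: mem_set; apply: AM => //; exact: AV.
Qed.

Lemma subgroupI (G : groupType) (A B : set G) :
  is_subgroup A -> is_subgroup B -> is_subgroup (A `&` B).
Proof.
move=> [A1 AM AV] [B1 BM BV].
by split=> // [x y [? ?] [? ?]|x [? ?]]; split; auto.
Qed.

Definition ltrans (G : groupType) (x : G) (A : set G) : set G := [set x * a | a in A].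

Lemma ltransM (G : groupType) (x y : G) (A : set G) :
  ltrans x (ltrans y A) = ltrans (x * y) A.
Proof.
by rewrite /ltrans image_comp; apply: eq_imagel => a _ /=; rewrite mulgA.
Qed.

Lemma ltrans1 (G : groupType) (A : set G) : ltrans 1 A = A.
Proof. by rewrite -[RHS]image_id; apply: eq_imagel => a _; rewrite mul1g. Qed.

Lemma ltrans_eq (G : groupType) (A : set G) (x y : G) :
  is_subgroup A -> ltrans x A = ltrans y A <-> A (x^-1 * y).
Proof.
move=> [A1 AM AV]; split=> [e|xy].
  have : ltrans y A y by exists 1; rewrite ?mulg1.
  by rewrite -e => -[a Aa <-]; rewrite mulKg.
apply/seteqP; split=> _ [a Aa <-].
  exists ((x^-1 * y)^-1 * a); first by apply: AM => //; exact: AV.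
  by rewrite invgM invgK !mulgA mulgV mul1g.
by exists (x^-1 * y * a); [exact: AM|rewrite !mulgA mulgV mul1g].
Qed.

Section Hom.
Variables (G : groupType) (Q : finGroupType) (phi : {multiplicative G -> Q}).

Lemma gmulf_one : phi 1 = 1.
Proof. by apply: (mulgI (phi 1)); rewrite -gmulfM !mulg1. Qed.

Lemma gmulf_inv x : phi x^-1 = (phi x)^-1.
Proof. by apply: (mulgI (phi x)); rewrite -gmulfM !mulgV gmulf_one. Qed.

(** A finite set rather than a classical one, so that Sylow theory applies to images. *)
Definition im_set (A : set G) : {set Q} :=
  [set q : Q | `[< exists2 x, A x & phi x = q >]]%SET.

Lemma im_setP A q : reflect (exists2 x, A x & phi x = q) (q \in im_set A).
Proof. by rewrite finset.in_set; exact: asboolP. Qed.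

Lemma mem_im_set (A : set G) x : A x -> phi x \in im_set A.
Proof. by move=> Ax; apply/im_setP; exists x. Qed.

Lemma im_group_set A : is_subgroup A -> group_set (im_set A).
Proof.
move=> [A1 AM AV]; apply/group_setP; split.
  by rewrite -gmulf_one mem_im_set.
move=> _ _ /im_setP[x Ax <-] /im_setP[y Ay <-].
by rewrite -gmulfM mem_im_set //; exact: AM.
Qed.

Lemma subgroup_preim (H : {group Q}) : is_subgroup [set x | phi x \in H].
Proof.
split=> /= [|x y|x]; first by rewrite gmulf_one group1.
  by rewrite gmulfM; exact: groupM.
by rewrite gmulf_inv groupV.
Qed.

(* The map A/D -> phi(A)/phi(D) is onto and all its fibres are translates of the
   one over phi(D). *)
Lemma group_index_im A D (sA : is_subgroup A) (sD : is_subgroup D) :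
    D `<=` A -> finite_set (left_cosets A D) ->
  group_index A D = (#|im_set A : im_set D|%g *
    group_index (A `&` [set x | phi x \in im_set D]) D)%N.
Proof.
move=> DA fin; set E := A `&` _.
have [A1 AM AV] := sA.
pose GD := group (im_group_set sD); pose GA := group (im_group_set sA).
(* A section of [phi] over the image of [A]; nothing is asked of [r] elsewhere. *)
have [r rP] : exists r : Q -> G, forall q, q \in im_set A -> A (r q) /\ phi (r q) = q.
  suff /choice[r rP] : forall q, exists x, q \in im_set A -> A x /\ phi x = q by exists r.
  move=> q; case: (boolP (q \in im_set A)) => [/im_setP[x Ax xq]|_]; first by exists x.
  by exists 1.
pose Y := [set` lcosets GD GA].
have reprY y : Y y -> repr y \in im_set A /\ y = repr y *: GD.
  case/lcosetsP => q qA ->.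
  have : repr (q *: GD) \in q *: GD by apply: (mem_repr q); rewrite lcoset_refl.
  case/lcosetP => s sD' e; rewrite e; split; first last.
    by rewrite lcosetM (lcoset_id sD').
  case/im_setP: sD' => d Dd <-; rewrite (groupM (G := GA)) //.
  by rewrite mem_im_set //; exact: DA.
(* A coset of [D] in the fibre [E] is translated by the lift of the representative of [y]. *)
have bij : set_bij (Y `*` left_cosets E D) (left_cosets A D)
    (fun u => ltrans (r (repr u.1)) u.2).
  split.
  - move=> [y u] [/= /reprY[/rP[Ar _] _] [e [Ae _] <-]].
    by exists (r (repr y) * e); [exact: AM|rewrite -/(ltrans e D) ltransM].
  - move=> [y u] [z v] /set_mem[/= /reprY[/rP[Ay ry] yE] [e [Ae eD] <-]].
    move=> /set_mem[/= /reprY[/rP[Az rz] zE] [e' [Ae' eD'] <-]].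
    rewrite -/(ltrans e D) -/(ltrans e' D) !ltransM => /ltrans_eq - /(_ sD) De.
    (* Both [e] and [e'] map into the image of [D], so applying [phi] to [De] compares only the
       representatives of [y] and [z]. *)
    have yz : y = z.
      rewrite yE zE; apply/lcoset_eqP; rewrite mem_lcoset.
      have := mem_im_set De; rewrite gmulfM gmulf_inv !gmulfM ry rz invgM.
      rewrite -[im_set D]/(gval GD) -!mulgA (groupMl _ (groupVr (eD : phi e \in GD))) mulgA.
      by rewrite (groupMr _ (eD' : phi e' \in GD)) -groupV invgM invgK.
    rewrite -yz in De *; congr (_, _); apply/ltrans_eq => //.
    by move: De; rewrite invgM -!mulgA mulKg.
  - move=> _ [x Ax <-]; set y := phi x *: GD.
    have Yy : Y y by apply/lcosetsP; exists (phi x); rewrite ?mem_im_set.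
    have [/rP[Ay ry] yE] := reprY _ Yy.
    exists (y, ltrans ((r (repr y))^-1 * x) D); last first.
      by rewrite /= ltransM mulgA mulgV mul1g.
    split=> //=; exists ((r (repr y))^-1 * x) => //; split=> /=.
      by apply: AM => //; exact: AV.
    rewrite gmulfM gmulf_inv ry -[_ \in _]/(_ \in GD) -mem_lcoset -yE.
    by rewrite /y lcoset_refl.
have finY : finite_set Y by exact: finite_finset.
have finE : finite_set (left_cosets E D).
  by apply: sub_finite_set fin => _ [x [Ax _] <-]; exists x.
have /fcard_eq : (Y `*` left_cosets E D #= left_cosets A D)%card.
  by apply/card_set_bijP; eexists; exact: bij.
move=> /(_ (finite_setX finY finE) fin).
rewrite fset_setX // cardfsX => e; rewrite /group_index -e; congr muln.
by rewrite -(card_lcosets GA GD) card_fset_set_finset.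
Qed.

Lemma group_index_self (A : set G) : is_subgroup A -> group_index A A = 1%N.
Proof.
move=> sA; rewrite /group_index.
have -> : left_cosets A A = [set A].
  have [A1 AM AV] := sA.
  have trA x : A x -> ltrans x A = A.
    move=> Ax; rewrite -[RHS]ltrans1; apply/ltrans_eq => //.
    by rewrite mulg1; exact: AV.
  apply/seteqP; split=> [_ [x Ax <-]|_ ->]; first exact: trA.
  by exists 1 => //; exact: trA.
by rewrite fset_set1 cardfs1.
Qed.

(** Each left coset is the preimage of a left coset of [H], and [Q] has finitely many subsets. *)
Lemma finite_left_cosets_preim (H : {group Q}) :
  finite_set (left_cosets [set: G] [set x | phi x \in H]).
Proof.
pose P (B : {set Q}) : set G := [set x | phi x \in B].
have fin : finite_set [set: {set Q}] by exact: finite_finset.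
apply: (sub_finite_set _ (finite_image P fin)) => _ [x _ <-].
exists (phi x *: H) => //; apply/seteqP; split=> [y|_ [z /= zH <-]].
  rewrite /P /= mem_lcoset => xy; exists (x^-1 * y); last by rewrite mulgA mulgV mul1g.
  by rewrite /= gmulfM gmulf_inv.
by rewrite /P /= gmulfM mem_lcoset mulKg.
Qed.

Definition preim_vertex (H : {group Q}) : fi_subgroup G :=
  FiSubgroup ((group_closed_subgroup _).2 (subgroup_preim H))
             (finite_left_cosets_preim H).

Lemma fi_subgroupP (A : fi_subgroup G) : is_subgroup A.
Proof. exact/group_closed_subgroup/fi_group_closed. Qed.

Definition im_group (A : fi_subgroup G) : {group Q} :=
  group (im_group_set (fi_subgroupP A)).

Lemma odd_index_im (A D : set G) : is_subgroup A -> is_subgroup D -> D `<=` A ->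
  odd (group_index A D) -> odd #|im_set A : im_set D|.
Proof.
move=> sA sD DA oddAD.
(* An infinite index has the junk value 0, which is even, so oddness forces finiteness. *)
have fin : finite_set (left_cosets A D).
  apply: contrapT => infin; move: oddAD; rewrite /group_index /fset_set.
  by case: pselect => // _; rewrite cardfs0.
by move: oddAD; rewrite group_index_im // oddM => /andP[].
Qed.

Lemma edge_odd_index p (A B : fi_subgroup G) : odd p -> plocal_comm_graph p A B ->
  odd #|im_set A : im_set (A `&` B)| /\ odd #|im_set B : im_set (A `&` B)|.
Proof.
move=> oddp /asboolP[_ [k e]].
have : odd (group_index A (A `&` B) * group_index B (A `&` B)).
  by rewrite e oddX oddp orbT.
rewrite oddM => /andP[oA oB].
have sA := fi_subgroupP A; have sB := fi_subgroupP B.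
by split; apply: odd_index_im => //; try exact: subgroupI; move=> x [].
Qed.

Hypothesis phi_surj : forall q, exists x, phi x = q.

Lemma im_preim (H : {group Q}) : im_set [set x | phi x \in H] = H.
Proof.
apply/setP => q; apply/im_setP/idP => [[x /= xH <-] //|qH].
by have [x xq] := phi_surj q; exists x; rewrite /= ?xq.
Qed.

Lemma preim_edge p k (H K : {group Q}) : H \subset K -> #|K : H| = (p ^ k)%N ->
    #|K : H| != 1%N ->
  plocal_comm_graph p (preim_vertex H) (preim_vertex K) /\
  plocal_comm_graph p (preim_vertex K) (preim_vertex H).
Proof.
move=> HK eKH KH1.
have sH := subgroup_preim H; have sK := subgroup_preim K.
have sub : [set x | phi x \in H] `<=` [set x | phi x \in K].
  by move=> x /=; exact/fintype.subsetP.
have fin : finite_set (left_cosets [set x | phi x \in K] [set x | phi x \in H]).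
  by apply: sub_finite_set (finite_left_cosets_preim H) => _ [x _ <-]; exists x.
(* The subgroup is the whole fibre over [H], so the second factor in [group_index_im] is 1. *)
have iKH : group_index [set x | phi x \in K] [set x | phi x \in H] = #|K : H|.
  by rewrite group_index_im // !im_preim (setIidr sub) group_index_self ?muln1.
have neq : [set x | phi x \in H] <> [set x | phi x \in K].
  by move=> e; move: KH1; rewrite -iKH e group_index_self.
have IH := setIidl sub; have IK := setIidr sub.
split; apply/asboolP; split=> /=; [exact: neq| |exact/nesym|]; exists k.
  by rewrite IH iKH group_index_self // mul1n.
by rewrite IK iKH group_index_self // muln1.
Qed.

End Hom.
End Cosets.

(** * Distances *)

Section Distance.
Local Open Scope classical_set_scope.
Local Open Scope group_scope.

Variables (G : groupType) (T : finType) (phi : {multiplicative G -> {perm T}}).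
Implicit Types (A B : fi_subgroup G) (f g : T -> T).

(** By odd index, the Sylow property passes down to the image of the intersection, giving [g], and
    up to the image of [B]. As [matching_group g] also lies in the image of [A], where
    [matching_group f] is Sylow, the disagreement bound applies. *)
Lemma edge_matching A B f : plocal_comm_graph 3 A B -> near_matching f ->
    2.-Sylow(im_group phi A) (matching_group f) ->
  exists g, [/\ near_matching g, 2.-Sylow(im_group phi B) (matching_group g) &
    #|disagreement f g| <= 3].
Proof.
move=> AB fm sylf; have [oA oB] := edge_odd_index (p := 3) phi isT AB.
have sI := subgroupI (fi_subgroupP A) (fi_subgroupP B).
pose D := group (im_group_set phi sI).
have sub (E : fi_subgroup G) : A `&` B `<=` E -> D \subset im_group phi E.
  move=> IE; apply/fintype.subsetP => _ /im_setP[x Ix <-].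
  by apply: mem_im_set; exact: IE.
have DA : D \subset im_group phi A by apply: sub => x [].
have DB : D \subset im_group phi B by apply: sub => x [].
have [g gm sylg] := sylow_matching_odd_index fm sylf DA oA.
exists g; split=> //.
  exact: (@sylow_odd_index _ _ _ (group (matching_group_set gm.1)) sylg DB oB).
apply: sylow_matching_disagreement fm gm sylf _.
exact: fintype.subset_trans (pHall_sub sylg) DA.
Qed.

Lemma walk_matching n A B f : walk (@plocal_comm_graph G 3) n A B -> near_matching f ->
    2.-Sylow(im_group phi A) (matching_group f) ->
  exists g, [/\ near_matching g, 2.-Sylow(im_group phi B) (matching_group g) &
    #|disagreement f g| <= 3 * n].
Proof.
case=> s [sp <- <-]; elim: s A f sp => [|C s IH] A f /=.
  move=> _ fm sylf; exists f; split=> //.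
  by rewrite leqn0 cards_eq0; apply/eqP/setP => x; rewrite !finset.inE eqxx.
move=> /andP[AC sp] fm sylf.
have [g [gm sylg fg]] := edge_matching AC fm sylf.
have [h [hm sylh gh]] := IH C g sp gm sylg.
exists h; split=> //; apply: leq_trans (disagreement_trans f g h) _.
by rewrite mulnS leq_add.
Qed.

Hypothesis phi_surj : forall q, exists x, phi x = q.

Definition matching_vertex f (fK : involutive f) : fi_subgroup G :=
  preim_vertex phi (group (matching_group_set fK)).

(** The walk yields a matching [h] whose group is Sylow in the image of the last vertex, which is
    [matching_group g]; passing from [h] to [g] accounts for the extra 3. *)
Lemma walk_matching_vertex n f g (fK : involutive f) (gK : involutive g) :
    near_matching f -> near_matching g ->
    walk (@plocal_comm_graph G 3) n (matching_vertex fK) (matching_vertex gK) ->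
  #|disagreement f g| <= 3 * n.+1.
Proof.
move=> fm gm w.
have im h (hK : involutive h) :
    im_group phi (matching_vertex hK) = group (matching_group_set hK).
  by apply: val_inj; exact: im_preim.
have syl h (hK : involutive h) :
    2.-Sylow(im_group phi (matching_vertex hK)) (matching_group h).
  rewrite im (pHallE _ _ (group (matching_group_set hK))) subxx /=.
  by rewrite part_pnat_id //; exact: matching_pgroup.
have [h [hm sylh fh]] := walk_matching w fm (syl _ fK).
apply: leq_trans (disagreement_trans f h g) _; rewrite mulnS addnC leq_add //.
by apply: sylow_matching_disagreement hm gm sylh _; rewrite im.
Qed.

Lemma walk_rcons (V : Type) (e : rel V) n x y z :
  walk e n x y -> e y z -> walk e n.+1 x z.
Proof.
move=> [s [xs <- <-]] yz; exists (rcons s z).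
by rewrite rcons_path last_rcons size_rcons xs.
Qed.

(** The two added edges pass through the preimage of [K]. *)
Lemma index3_walk n A (H K L : {group {perm T}}) :
    H \subset K -> L \subset K -> #|K : H| = 3 -> #|K : L| = 3 ->
    walk (@plocal_comm_graph G 3) n A (preim_vertex phi H) ->
  walk (@plocal_comm_graph G 3) n.+2 A (preim_vertex phi L).
Proof.
move=> HK LK iH iL w.
have [|HKe _] := preim_edge (p := 3) (k := 1) phi_surj HK iH; first by rewrite iH.
have [|_ KLe] := preim_edge (p := 3) (k := 1) phi_surj LK iL; first by rewrite iL.
exact: walk_rcons (walk_rcons w HKe) KLe.
Qed.

End Distance.

(** * Connecting walks and unboundedness of the diameter *)

Section Diameter.
Local Open Scope classical_set_scope.
Import Order.POrderTheory Num.Theory.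

Lemma hole_matching_walk m (G : groupType)
    (phi : {multiplicative G -> {perm 'I_(m.*2.+1)}})
    (phi_surj : forall q, exists x, phi x = q) j (jm : j <= m) :
  exists n, walk (@plocal_comm_graph G 3) n
    (matching_vertex phi (near_matching_hole (leq0n m)).1)
    (matching_vertex phi (near_matching_hole jm).1).
Proof.
elim: j jm => [|j IH] jm.
  (* The vertex depends on the proof of [j <= m], so the two proofs of [0 <= m] must be
     identified. *)
  by rewrite (bool_irrelevance jm (leq0n m)); exists 0, [::].
have [n w] := IH (ltnW jm).
have [K [jK SK ij iS]] := hole_matching_move jm.
exists n.+2.
pose Mj := group (matching_group_set (near_matching_hole (ltnW jm)).1).
pose MS := group (matching_group_set (near_matching_hole jm).1).
exact: (index3_walk (H := Mj) (L := MS) phi_surj jK SK ij iS w).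
Qed.

(** The existing walk puts [x] and [y] in one component, and the bound on all walks makes their
    distance exceed any given positive real. *)
Lemma connected_diameter_infty (R : realType) (V : Type) (e : rel V) :
  (forall N, exists x y, (exists n, walk e n x y) /\
     forall n, walk e n x y -> N <= n) ->
  connected_diameter R e = +oo%E.
Proof.
move=> far; apply/eqyP => r r0.
have [x [y [xy yN]]] := far (Num.bound r).
apply: (@le_trans _ _ (graph_dist R e x y)).
  apply: le_ereal_inf_tmp => _ [n /= /yN Nn <-].
  rewrite lee_fin; apply/ltW/(lt_le_trans (archi_boundP (ltW r0))).
  by rewrite ler_nat.
apply: (@le_trans _ _ (diameter R e (component e x))).
  apply: ereal_sup_ubound; exists (x, y) => //; split=> //.
  by exists 0, [::].
by apply: ereal_sup_ubound; exists x.
Qed.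

End Diameter.

Theorem corollary4 (R : realType) (F : groupType) :
  free_group F -> nonabelian F ->
  connected_diameter R (@plocal_comm_graph F 3) = +oo%E.
Proof.
move=> freeF nabF; apply: connected_diameter_infty => N.
(* With this [m] all 2m+1 = 4N+3 points change partner, and 4N+3 <= 3(n+1) forces N <= n. *)
pose m := (2 * N).+1.
have [phi phi_surj] := free_group_surj freeF nabF (@gen_tperm_cycle m.*2).
exists (matching_vertex phi (near_matching_hole (leq0n m)).1).
exists (matching_vertex phi (near_matching_hole (leqnn m)).1).
split=> [|n w]; first exact: hole_matching_walk.
have := walk_matching_vertex phi_surj (near_matching_hole _) (near_matching_hole _) w.
by rewrite hole_matching_disagreement //; lia.
Qed.
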